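(* Let $\mathcal{K}$ be a class of graphs with bounded expansion. (a) Let $p$ be an odd positive integer. Then there exists a constant $C=C(\mathcal{K},p)$ such that for every graph $G\in\mathcal{K}$ we have $\chi(G^{[\natural p]})\le C$. (b) Let $p$ be an even positive integer. Then there exists a constant $C'=C'(\mathcal{K},p)$ such that for every graph $G\in\mathcal{K}$ we have $\chi(G^{[\natural p]})\le C'\cdot\Delta(G)$.
   Context: All graphs are finite, undirected, simple and without loops. $\chi$ denotes the chromatic number, $\Delta(G)$ the maximum degree, and $d_G(x,y)$ the distance between $x$ and $y$ in $G$. For a graph $G=(V,E)$ and a positive integer $p$, the exact distance-$p$ graph $G^{[\natural p]}$ has vertex set $V$, and $xy$ is an edge if and only if $d_G(x,y)=p$. Weak colouring numbers: let $L$ be a linear ordering of $V$ and $k$ a positive integer. A vertex $x$ is weakly $k$-accessible from $y$ if $x<_L y$ and there is an $xy$-path of length at most $k$ (length = number of edges) all of whose internal vertices $z$ satisfy $x<_L z$. Let $Q_{L,k}(y)$ be the set of vertices weakly $k$-accessible from $y$, and $\mathrm{wcol}_k(G)=1+\min_L\max_{y\in V}|Q_{L,k}(y)|$, the minimum being over all linear orderings $L$ of $V$. A class of graphs $\mathcal{K}$ has bounded expansion if and only if there exist constants $c_k$, $k=1,2,\ldots$, such that $\mathrm{wcol}_k(G)\le c_k$ for all $k$ and all $G\in\mathcal{K}$.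
   Formalization: In part (b) the bound is stated only for graphs G with Δ(G) ≥ 1, since for a nonempty edgeless graph Δ(G) = 0 while the exact distance graph has chromatic number 1, so the bound fails as written. *)

(* Defs.v *)
From mathcomp Require Import all_boot.

Set Implicit Arguments.
Unset Strict Implicit.
Unset Printing Implicit Defensive.

Record sgraph := SGraph {
  svertex :> finType;
  sedge : rel svertex;
  sedge_sym : symmetric sedge;
  sedge_irr : irreflexive sedge
}.

(** A class of graphs; it is not required to be closed under isomorphism. *)
Definition graph_class := sgraph -> Prop.

Definition degree (G : sgraph) (x : G) : nat := #|[set y : G | sedge x y]|.

Definition max_degree (G : sgraph) : nat := \max_(x : G) degree x.

Definition proper_coloring (G : sgraph) (k : nat) (f : {ffun G -> 'I_k}) : bool :=
  [forall x : G, forall y : G, sedge x y ==> (f x != f y)].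

Definition colorable (G : sgraph) (k : nat) : bool :=
  [exists f : {ffun G -> 'I_k}, proper_coloring f].

Lemma colorable_ex (G : sgraph) : exists k, colorable G k.
Proof.
exists #|G|; apply/existsP; exists [ffun x => enum_rank x].
apply/forallP => x; apply/forallP => y; apply/implyP => xy.
rewrite !ffunE (inj_eq enum_rank_inj).
by apply: contraTneq xy => ->; rewrite sedge_irr.
Qed.

Definition chi (G : sgraph) : nat := ex_minn (colorable_ex G).

(** [is_path x p y]: the vertices [x :: p], pairwise distinct, form a path from
    [x] to [y]; its length (number of edges) is [size p]. *)
Definition is_path (G : sgraph) (x : G) (p : seq G) (y : G) : bool :=
  [&& path (@sedge G) x p, uniq (x :: p) & last x p == y].

Definition internal (G : sgraph) (x : G) (p : seq G) : seq G :=
  behead (belast x p).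

(** The least length of a path from [x] to [y], or [None] (infinite distance)
    when there is none; a path has fewer than [#|G|] edges. *)
Definition dist (G : sgraph) (x y : G) : option nat :=
  ohead [seq n <- iota 0 #|G| | [exists p : n.-tuple G, is_path x p y]].

Lemma is_path_rev (G : sgraph) (x y : G) (p : seq G) :
  is_path x p y -> is_path y (rev (belast x p)) x.
Proof.
case/and3P => xp up /eqP <-; apply/and3P; split.
- rewrite rev_path; apply: sub_path xp => u v.
  by rewrite sedge_sym.
- by rewrite -rev_rcons -lastI rev_uniq.
- by case: p {xp up} => [|z p] //=; rewrite rev_cons last_rcons.
Qed.

Lemma dist_sym (G : sgraph) : forall x y : G, dist x y = dist y x.
Proof.
suff H (x y : G) n : [exists p : n.-tuple G, is_path x p y] ->
    [exists p : n.-tuple G, is_path y p x].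
  move=> x y; congr ohead; apply: eq_filter => n.
  by apply/idP/idP; apply: H.
case/existsP => p /is_path_rev xpy; apply/existsP.
have sz : size (rev (belast x p)) == n by rewrite size_rev size_belast size_tuple.
by exists (Tuple sz).
Qed.

(** The condition [x != y] only matters for [p = 0], where it removes loops. *)
Definition exact_dist_rel (G : sgraph) (p : nat) : rel G :=
  fun x y => (x != y) && (dist x y == Some p).

Lemma exact_dist_sym (G : sgraph) (p : nat) : symmetric (@exact_dist_rel G p).
Proof. by move=> x y; rewrite /exact_dist_rel eq_sym (dist_sym x y). Qed.

Lemma exact_dist_irr (G : sgraph) (p : nat) : irreflexive (@exact_dist_rel G p).
Proof. by move=> x; rewrite /exact_dist_rel eqxx. Qed.

Definition exact_dist_graph (G : sgraph) (p : nat) : sgraph :=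
  SGraph (@exact_dist_sym G p) (@exact_dist_irr G p).

(** A linear ordering is given by its strict part: [(x, y) \in L] is [x <_L y]. *)
Definition linear_order (T : finType) (L : {set T * T}) : bool :=
  [&& [forall x, (x, x) \notin L],
      [forall x, forall y, forall z,
         ((x, y) \in L) && ((y, z) \in L) ==> ((x, z) \in L)]
    & [forall x, forall y, (x != y) ==> ((x, y) \in L) || ((y, x) \in L)]].

Definition weakly_accessible (G : sgraph) (L : {set G * G}) (k : nat)
    (x y : G) : bool :=
  ((x, y) \in L) &&
  [exists n : 'I_k.+1, exists p : n.-tuple G,
     is_path x p y && all (fun z => (x, z) \in L) (internal x p)].

Definition weak_reach (G : sgraph) (L : {set G * G}) (k : nat) (y : G) : {set G} :=
  [set x : G | weakly_accessible L k x y].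

Definition max_weak_reach (G : sgraph) (L : {set G * G}) (k : nat) : nat :=
  \max_(y : G) #|weak_reach L k y|.

Definition weak_reach_value (G : sgraph) (k m : nat) : bool :=
  [exists L : {set G * G}, linear_order L && (max_weak_reach L k == m)].

Lemma linear_order_ex (T : finType) : exists L : {set T * T}, linear_order L.
Proof.
exists [set u | enum_rank u.1 < enum_rank u.2]; apply/and3P; split.
- by apply/forallP => x; rewrite inE ltnn.
- apply/forallP => x; apply/forallP => y; apply/forallP => z; rewrite !inE /=.
  by apply/implyP => /andP[]; apply: ltn_trans.
- apply/forallP => x; apply/forallP => y; rewrite !inE /=; apply/implyP.
  by rewrite -neq_ltn -(inj_eq enum_rank_inj).
Qed.

Lemma weak_reach_value_ex (G : sgraph) (k : nat) :
  exists m, weak_reach_value G k m.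
Proof.
have [L lL] := linear_order_ex G; exists (max_weak_reach L k).
by apply/existsP; exists L; rewrite lL eqxx.
Qed.

Definition wcol (k : nat) (G : sgraph) : nat :=
  1 + ex_minn (weak_reach_value_ex G k).

Definition bounded_expansion (K : graph_class) : Prop :=
  exists c : nat -> nat, forall k, 0 < k -> forall G, K G -> wcol k G <= c k.

(* Main.v *)
(** Fix an ordering [L] that realises the weak colouring number and send each
    vertex [x] to the [L]-least vertex [m x] of the ball of radius [h] around [x].
    If [d(x, y) = p <= 2h + 1], every vertex of the walk from [m x] through [x] and
    [y] to [m y] lies in one of the two balls, so the smaller of [m x], [m y] is
    weakly [(2h + p)]-accessible from the other unless they coincide.  Hence a
    greedy colouring along [L], composed with [m], separates [x] and [y] whenever
    [m x <> m y].  For [p = 2h + 1] the balls are disjoint.  For [p = 2h] they may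
    share [m x = m y], which is then at distance exactly [h] from both; the first
    edges of geodesics from it to [x] and to [y] differ, and labelling them costs
    a factor [Delta]. *)
Require Import Defs.
From mathcomp Require Import all_boot zify.

Set Implicit Arguments.
Unset Strict Implicit.
Unset Printing Implicit Defensive.

(** * Walks of bounded length and their relation to distance *)

Section Walks.
Variable G : sgraph.
Implicit Types (x y z : G) (s : seq G).

(** Walks instead of paths: concatenation then needs no check of distinctness. *)
Definition within (n : nat) (x y : G) : bool :=
  [exists k : 'I_n.+1, exists s : k.-tuple G,
     path (@sedge G) x s && (last x s == y)].

Lemma withinP n x y :
  reflect (exists s, [/\ path (@sedge G) x s, last x s = y & size s <= n])
          (within n x y).
Proof.
apply: (iffP existsP) => [[k /existsP[s /andP[xs /eqP sy]]]|[s [xs sy sn]]].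
  by exists s; split; rewrite // size_tuple -ltnS.
exists (Ordinal (sn : size s < n.+1)); apply/existsP; exists (in_tuple s).
by rewrite xs sy eqxx.
Qed.

Lemma within_refl n x : within n x x.
Proof. by apply/withinP; exists [::]. Qed.

Lemma walk_rev x s : path (@sedge G) x s ->
  path (@sedge G) (last x s) (rev (belast x s)) /\
  last (last x s) (rev (belast x s)) = x.
Proof.
move=> xs; split.
  by rewrite rev_path; apply: sub_path xs => u v; rewrite sedge_sym.
by case: s {xs} => [|z s] //=; rewrite rev_cons last_rcons.
Qed.

Lemma within_sym n : symmetric (within n).
Proof.
suff H x y : within n x y -> within n y x by move=> x y; apply/idP/idP; apply: H.
move=> /withinP[s [/walk_rev[ys sx] <- sn]]; apply/withinP.
by exists (rev (belast x s)); rewrite size_rev size_belast.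
Qed.

Lemma within_trans m n y x z : within m x y -> within n y z -> within (m + n) x z.
Proof.
move=> /withinP[s [xs sy sm]] /withinP[t [yt tz tn]]; apply/withinP.
by exists (s ++ t); rewrite cat_path last_cat size_cat sy xs leq_add.
Qed.

Lemma within_split x s z : path (@sedge G) x s -> z \in x :: s ->
  exists i j, [/\ i + j = size s, within i x z & within j z (last x s)].
Proof.
move=> xs; rewrite inE => /predU1P[->|zs].
  by exists 0, (size s); split; rewrite ?within_refl //; apply/withinP; exists s.
case/splitPr: zs xs => s1 s2; rewrite -cat_rcons cat_path last_rcons => /andP[xs zs].
exists (size s1).+1, (size s2); split.
- by rewrite size_cat size_rcons.
- by apply/withinP; exists (rcons s1 z); rewrite last_rcons size_rcons.
- by apply/withinP; exists s2; rewrite last_cat last_rcons.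
Qed.

Lemma leq_within m n x y : m <= n -> within m x y -> within n x y.
Proof.
move=> mn /withinP[s [xs sy sm]]; apply/withinP; exists s.
by split; rewrite // (leq_trans sm).
Qed.

(** The inclusion of [t] in [s] lets order conditions pass from a walk to the path extracted from
    it. *)
Lemma walk_path x s : path (@sedge G) x s ->
  exists t, [/\ is_path x t (last x s), {subset t <= s} & size t <= size s].
Proof.
case/shortenP=> t xt ut ts; exists t; split=> //; first by rewrite /is_path xt ut eqxx.
by apply: uniq_leq_size => //; case/andP: ut.
Qed.

Lemma dist_within p x y : dist x y = Some p -> within p x y.
Proof.
rewrite /dist; set f := filter _ _ => fp.
have: p \in f by case: f fp => //= a f [->]; rewrite mem_head.
rewrite mem_filter => /andP[/existsP[s /and3P[xs _ /eqP sy]] _].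
by apply/withinP; exists s; rewrite size_tuple.
Qed.

Lemma dist_min p n x y : dist x y = Some p -> within n x y -> p <= n.
Proof.
rewrite /dist => fp /withinP[s [xs sy sn]].
have [t [xt _ ts]] := walk_path xs.
apply: leq_trans (leq_trans ts sn); move: fp; set f := filter _ _ => fp.
have tf : size t \in f.
  rewrite mem_filter; apply/andP; split.
    by apply/existsP; exists (in_tuple t); rewrite -sy.
  rewrite mem_iota /=; case/and3P: xt => _ /card_uniqP xt _.
  (* Distinct vertices force [size t < #|G|], the range searched by [dist]. *)
  by rewrite add0n -[(size t).+1]xt max_card.
have: sorted leq f by apply: sorted_filter (iota_sorted _ _); apply: leq_trans.
case: f fp tf => //= a f [->] tf /(order_path_min leq_trans)/allP fa.
by move: tf; rewrite inE => /predU1P[->|/fa].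
Qed.

End Walks.

(** * Ranks, greedy colouring and labels of neighbours *)

Lemma linear_order_rank (T : finType) (L : {set T * T}) : linear_order L ->
  exists r : T -> nat, injective r /\ forall x y, ((x, y) \in L) = (r x < r y).
Proof.
case/and3P=> /forallP irr /forallP tr /forallP tot.
have trL x y z : (x, y) \in L -> (y, z) \in L -> (x, z) \in L.
  by move=> xy yz; move: (tr x) => /forallP/(_ y)/forallP/(_ z); rewrite xy yz.
(* The rank of [x] is its number of predecessors. *)
pose r x := #|[set z | (z, x) \in L]|.
have rlt x y : (x, y) \in L -> r x < r y.
  move=> xy; apply: proper_card; apply/properP; split.
    by apply/subsetP=> z; rewrite !inE => /trL; apply.
  by exists x; rewrite !inE ?irr.
have totL x y : x != y -> (x, y) \in L \/ (y, x) \in L.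
  by move=> xy; apply/orP; move: (tot x) => /forallP/(_ y); rewrite xy.
exists r; split=> [x y rxy|x y].
  by apply/eqP; apply: contraT => /totL[] /rlt; rewrite rxy ltnn.
apply/idP/idP => [/rlt//|rxy].
have [xy|] := eqVneq x y; first by rewrite xy ltnn in rxy.
by case/totL=> // /rlt; rewrite ltnNge ltnW.
Qed.

Lemma greedy_coloring (T : finType) (r : T -> nat) (Q : rel T) (n : nat) :
  (forall x y, Q x y -> r x < r y) -> (forall y, #|[set x | Q x y]| <= n) ->
  exists a : T -> 'I_n.+1, forall x y, Q x y -> a x != a y.
Proof.
move=> Qr Qn.
have [k rk] : exists k, forall y, r y < k.
  by exists (\max_y r y).+1 => y; rewrite ltnS leq_bigmax.
suff [a aP] : exists a : T -> 'I_n.+1, forall x y, r y < k -> Q x y -> a x != a y.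
  by exists a => x y; apply: aP.
(* All vertices of rank [k] are coloured at once; [Q] never relates two of them. *)
elim: k {rk} => [|k [a aP]]; first by exists (fun=> ord0).
have free y : exists c, c \notin a @: [set x | Q x y].
  apply/existsP; apply: contraT; rewrite negb_exists => /forallP full.
  have := leq_trans (leq_imset_card a [set x | Q x y]) (Qn y).
  rewrite (eq_card (B := 'I_n.+1)) ?card_ord ?ltnn // => c.
  by rewrite (negbNE (full c)).
exists (fun y => if r y == k then xchoose (free y) else a y) => x y yk Qxy.
have xy := Qr _ _ Qxy.
rewrite (_ : (r x == k) = false) /=; last by apply/eqP; lia.
case: (r y =P k) => [_|ryk]; last by apply: aP => //; lia.
apply: contraNneq (xchooseP (free y)) => <-.
by apply: imset_f; rewrite inE.
Qed.

(** An arbitrary finite type of colours allows pairs in the even case. *)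
Lemma chi_le (G : sgraph) (T : finType) (f : G -> T) :
  (forall x y, sedge x y -> f x != f y) -> chi G <= #|T|.
Proof.
move=> fP; rewrite /chi; case: ex_minnP => k _; apply.
apply/existsP; exists [ffun x => enum_rank (f x)].
apply/forallP=> x; apply/forallP=> y; apply/implyP=> /fP.
by rewrite !ffunE (inj_eq enum_rank_inj).
Qed.

Lemma neighbour_label (G : sgraph) : 0 < max_degree G ->
  exists l : G -> G -> 'I_(max_degree G),
    forall u, {in [set v | sedge u v] &, injective (l u)}.
Proof.
move=> D0; pose N (u : G) := enum [set v | sedge u v].
have ltN u v : v \in N u -> index v (N u) < max_degree G.
  rewrite -index_mem => /leq_trans; apply; rewrite -cardE.
  exact: (leq_bigmax (F := @degree G)).
(* The label is the position of [v] among the neighbours of [u]; the default is reached only by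
   non-neighbours. *)
exists (fun u v => insubd (Ordinal D0) (index v (N u))) => u v w.
rewrite -mem_enum -[w \in _]mem_enum => vN wN /(congr1 val).
rewrite !val_insubd !ltN // => vw.
by rewrite -(nth_index v vN) vw nth_index.
Qed.

(** * Least vertices of balls and accessibility between them *)

Section LeastInBall.
Variables (G : sgraph) (L : {set G * G}) (r : G -> nat) (h : nat).
Hypotheses (r_inj : injective r) (LE : forall x y, ((x, y) \in L) = (r x < r y)).

Definition ball_min (x : G) : G := [arg min_(z < x | within h x z) r z].

Lemma ball_min_within x : within h x (ball_min x).
Proof. by rewrite /ball_min; case: arg_minnP => //; apply: within_refl. Qed.

Lemma ball_min_le x z : within h x z -> r (ball_min x) <= r z.
Proof. by rewrite /ball_min; case: arg_minnP => [|u _]; [apply: within_refl|apply]. Qed.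

Lemma ball_min_accessible p x y : within p x y -> p <= h.*2.+1 ->
  r (ball_min x) < r (ball_min y) ->
  weakly_accessible L (h.*2 + p) (ball_min x) (ball_min y).
Proof.
move=> /withinP[s [xs sy sp]] ph rxy; rewrite /weakly_accessible LE rxy /=.
have := ball_min_within x; rewrite within_sym => /withinP[s1 [us1 s1x s1h]].
have /withinP[s2 [ys2 s2v s2h]] := ball_min_within y.
have ux z : within h x z -> r (ball_min x) <= r z by apply: ball_min_le.
(* By [rxy], the minimum over the ball of [x] also bounds the ball of [y]. *)
have uy z : within h y z -> r (ball_min x) <= r z.
  by move/ball_min_le; apply: leq_trans (ltnW rxy).
set u := ball_min x in us1 s1x ux uy rxy *; set v := ball_min y in s2v rxy *.
pose w := s1 ++ s ++ s2.
have uw : path (@sedge G) u w by rewrite !cat_path us1 s1x xs sy ys2.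
have wv : last u w = v by rewrite !last_cat s1x sy.
have wr z : z \in w -> r u <= r z.
  rewrite !mem_cat => /or3P[] zs.
  - have [|i [j [ij _]]] := @within_split _ u s1 z us1; first by rewrite inE zs orbT.
    by rewrite s1x within_sym => /leq_within-zx; apply/ux/zx; lia.
  - have [|i [j [ij]]] := @within_split _ x s z xs; first by rewrite inE zs orbT.
    rewrite sy [within j _ _]within_sym => /leq_within-xz /leq_within-yz.
    (* Since [i + j <= 2h + 1], either [i <= h] or [j <= h]. *)
    have [ih|ih] := leqP i h; first exact/ux/xz.
    by apply/uy/yz; lia.
  - have [|i [j [ij yz _]]] := @within_split _ y s2 z ys2; first by rewrite inE zs orbT.
    by apply/uy/(leq_within _ yz); lia.
have [t [ut tw ts]] := walk_path uw; rewrite wv in ut.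
have th : size t < (h.*2 + p).+1.
  rewrite ltnS (leq_trans ts) // !size_cat; lia.
apply/existsP; exists (Ordinal th); apply/existsP; exists (in_tuple t).
rewrite ut /=; apply/allP => z zt.
have {}zt : z \in t.
  case: (t) zt => //= a t' zt; apply: mem_belast; exact: zt.
(* Strictness: [u] starts the path [t] and does not recur on it. *)
rewrite LE ltn_neqAle (wr _ (tw _ zt)) andbT (inj_eq r_inj).
by apply: contraTneq zt => <-; case/and3P: ut => _ /andP[].
Qed.

End LeastInBall.

Lemma ball_min_coloring (G : sgraph) (h p : nat) : p <= h.*2.+1 ->
  exists (m : G -> G) (a : G -> 'I_(wcol (h.*2 + p) G)),
    (forall x, within h x (m x)) /\
    (forall x y, dist x y = Some p -> m x != m y -> a (m x) != a (m y)).
Proof.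
(* [L] attains the minimum [n], so [wcol] is exactly the [n + 1] colours of the greedy colouring. *)
move=> ph; rewrite /wcol; case: ex_minnP => n /existsP[L /andP[lL /eqP Ln]] _.
have [r [r_inj LE]] := linear_order_rank lL.
have Qr x y : weakly_accessible L (h.*2 + p) x y -> r x < r y.
  by case/andP; rewrite LE.
have Qn y : #|[set x | weakly_accessible L (h.*2 + p) x y]| <= n.
  rewrite -Ln; exact: (leq_bigmax (F := fun y => #|weak_reach L _ y|)).
have [a aP] := greedy_coloring Qr Qn.
exists (ball_min r h), a; split=> [x|x y dxy]; first exact: ball_min_within.
have xy := dist_within dxy.
rewrite -(inj_eq r_inj) neq_ltn => /orP[] rxy.
  exact/aP/(ball_min_accessible r_inj LE xy).
rewrite eq_sym; apply/aP/(ball_min_accessible r_inj LE) => //.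
by rewrite within_sym.
Qed.

Lemma chi_exact_dist_odd (G : sgraph) (h : nat) :
  chi (exact_dist_graph G h.*2.+1) <= wcol (h.*2 + h.*2.+1) G.
Proof.
have [m [a [mP aP]]] := ball_min_coloring G (leqnn h.*2.+1).
rewrite -[wcol _ _]card_ord; apply: (@chi_le (exact_dist_graph _ _) _ (a \o m)) => x y /andP[_ /eqP dxy].
apply: aP => //; apply/eqP => mxy.
have := within_trans (mP x); rewrite mxy => /(_ h y).
by rewrite within_sym => /(_ (mP y))/(dist_min dxy); lia.
Qed.

(** A nonempty edgeless graph has chromatic number 1 while the right-hand side would be 0, hence the
    positive maximum degree. *)
Lemma chi_exact_dist_even (G : sgraph) (h : nat) : 0 < h -> 0 < max_degree G ->
  chi (exact_dist_graph G h.*2) <= wcol (h.*2 + h.*2) G * max_degree G.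
Proof.
move=> h0 /neighbour_label[l l_inj].
have [m [a [mP aP]]] := ball_min_coloring G (leqnSn h.*2).
pose first_step x v := sedge (m x) v && within h.-1 v x.
pose g x := odflt x [pick v | first_step x v].
have gP x y : dist x y = Some h.*2 -> m x = m y -> first_step x (g x).
  move=> dxy mxy; rewrite /g; case: pickP => //= none.
  have := mP x; rewrite within_sym => /withinP[[|v s] /=].
    (* An empty walk means [m x = x], putting [y] within [h < 2h] of [x]. *)
    case=> _ mx _; have := mP y; rewrite -mxy mx within_sym.
    by move/(dist_min dxy); lia.
  case=> /andP[mv vs] sx sh; case/negP: (none v).
  by rewrite /first_step mv /=; apply/withinP; exists s; split=> //; lia.
suff : chi (exact_dist_graph G h.*2)
       <= #|{: 'I_(wcol (h.*2 + h.*2) G) * 'I_(max_degree G)}|.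
  by rewrite card_prod !card_ord.
pose f x := (a (m x), l (m x) (g x)).
apply: (@chi_le (exact_dist_graph _ _) _ f) => x y /andP[_ /eqP dxy].
rewrite xpair_eqE negb_and; have [mxy|mxy] := eqVneq (m x) (m y); last by rewrite aP.
have /andP[xg gx] := gP x y dxy mxy.
have /andP[yg gy] : first_step y (g y) by apply: (gP y x); rewrite // dist_sym.
rewrite mxy eqxx /=; apply/eqP => /l_inj; rewrite !inE -{1}mxy => /(_ xg yg) gxy.
(* A common first step would join [x] to [y] by a walk of length at most [2(h - 1)]. *)
have := gx; rewrite within_sym gxy => /within_trans/(_ gy)/(dist_min dxy); lia.
Qed.

Theorem theorem1p2 (K : graph_class) (hK : bounded_expansion K) :
  (forall p : nat, 0 < p -> odd p ->
     exists C : nat, forall G : sgraph, K G ->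
       chi (exact_dist_graph G p) <= C)
  /\
  (forall p : nat, 0 < p -> ~~ odd p ->
     exists C' : nat, forall G : sgraph, K G -> 0 < max_degree G ->
       chi (exact_dist_graph G p) <= C' * max_degree G).
Proof.
have [c cP] := hK; split=> p p0 podd.
- have -> : p = p./2.*2.+1 by rewrite -[LHS]odd_double_half podd.
  (* The index is [2p - 1]; in the even case it is [2p]. *)
  exists (c (p./2.*2 + p./2.*2.+1)) => G KG.
  by apply: leq_trans (chi_exact_dist_odd G _) _; apply: cP => //; lia.
- have pE : p = p./2.*2 by rewrite -[LHS]odd_double_half (negbTE podd).
  have h0 : 0 < p./2 by lia.
  rewrite pE; exists (c (p./2.*2 + p./2.*2)) => G KG D0.
  apply: leq_trans (chi_exact_dist_even h0 D0) _.
  by rewrite leq_mul2r cP ?orbT //; lia.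
Qed.
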